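(* For any unital ring $R$, $$\operatorname{cl}(R_q^{-1})=R \quad\Longleftrightarrow\quad \operatorname{cr}(R_q^{-1})=R .$$
   Context: Rings are associative. For elements $x,y$ of a unital ring $R$ write $x\perp y$ if $xRy=0$ and $yRx=0$. An element $u\in R$ is quasi-invertible, written $u\in R_q^{-1}$, if there exist $a,b\in R$ with $(1-ua)\perp(1-bu)$. $R^{-1}$ denotes the set of (two-sided) invertible elements. $\operatorname{cl}(R_q^{-1})$ is the set of $a\in R$ such that whenever $xa+b=1$ for some $x,b\in R$, there is $y\in R$ with $a+yb\in R_q^{-1}$. $\operatorname{cr}(R_q^{-1})$ is the set of $a\in R$ such that whenever $ax+b\in R^{-1}$ for some $x,b\in R$, there is $y\in R$ with $a+by\in R_q^{-1}$. *)

(* Defs.v *)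
From mathcomp Require Import all_boot all_algebra.
From mathcomp Require Import boolp classical_sets.

Set Implicit Arguments.
Unset Strict Implicit.
Unset Printing Implicit Defensive.

Import GRing.Theory.

Local Open Scope classical_set_scope.
Local Open Scope ring_scope.

(* Rings are [pzRingType]: associative, unital, not necessarily commutative,
   and possibly zero.  Invertibility is spelled out because [GRing.unit] is
   only available on [unitRingType], where it must be a boolean predicate. *)

Definition orth (R : pzRingType) (x y : R) : Prop :=
  (forall r : R, x * r * y = 0) /\ (forall r : R, y * r * x = 0).

Definition quasi_invertible (R : pzRingType) : set R :=
  [set u | exists a b : R, orth (1 - u * a) (1 - b * u)].

Definition invertible (R : pzRingType) : set R :=
  [set u | exists v : R, v * u = 1 /\ u * v = 1].

Definition cl (R : pzRingType) (S : set R) : set R :=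
  [set a | forall x b : R, x * a + b = 1 -> exists y : R, S (a + y * b)].

(* The hypothesis is membership in the invertible elements, whereas [cl] uses
   an equation with [1]; the two definitions are not literal mirror images. *)
Definition cr (R : pzRingType) (S : set R) : set R :=
  [set a | forall x b : R, invertible (a * x + b) ->
           exists y : R, S (a + b * y)].

(* Main.v *)
Require Import Defs.
From mathcomp Require Import all_boot all_algebra.
From mathcomp Require Import boolp classical_sets.

Set Implicit Arguments.
Unset Strict Implicit.
Unset Printing Implicit Defensive.

Import GRing.Theory.

Local Open Scope classical_set_scope.
Local Open Scope ring_scope.

(** Both conditions assert that a unimodular relation [a x + b = 1] can be
    corrected to a quasi-invertible element, one by changing [x] to [x + y b],
    the other by changing [a] to [a + b z].  If [u = x + y b] has quasi-inverse
    [v], then [w = a + b v (1 - y a)] and [e = x + (1 - x a) y] satisfy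
    [1 - w e = b (1 - v u) (1 - a y)] and
    [1 - e w = (1 - x a) (1 - u v) (1 - y a)], so [1 - u v] orthogonal to
    [1 - v u] yields [1 - w e] orthogonal to [1 - e w].  The converse is the
    same argument in the opposite ring. *)

Lemma orth_sym (R : pzRingType) (x y : R) : orth x y -> orth y x.
Proof. by case. Qed.

Lemma orth_mul (R : pzRingType) (c x d c' y d' : R) :
  orth x y -> orth (c * x * d) (c' * y * d').
Proof.
case=> xy yx; split=> r.
  have -> : c * x * d * r * (c' * y * d') = c * (x * (d * r * c') * y) * d'.
    by rewrite !mulrA.
  by rewrite xy mulr0 mul0r.
have -> : c' * y * d' * r * (c * x * d) = c' * (y * (d' * r * c) * x) * d.
  by rewrite !mulrA.
by rewrite yx mulr0 mul0r.
Qed.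

Lemma mul_1B1B (R : pzRingType) (x y : R) :
  (1 - x) * (1 - y) = 1 - (x + y - x * y).
Proof.
by rewrite mulrBr mulr1 mulrBl mul1r -[x + y - _]addrA [in RHS]opprD addrA.
Qed.

(** The witness merges [a] and [b] so that both defects factor, one with left factor [1 - u * a],
    the other with right factor [1 - b * u]; multiples of orthogonal elements stay orthogonal. *)
Lemma quasi_inverse_exists (R : pzRingType) (u : R) :
  quasi_invertible u -> exists v : R, orth (1 - u * v) (1 - v * u).
Proof.
case=> a [b ab]; exists (a + b - a * u * b).
have -> : 1 - u * (a + b - a * u * b) = 1 * (1 - u * a) * (1 - u * b).
  by rewrite mul1r mul_1B1B mulrBr mulrDr !mulrA.
have -> : 1 - (a + b - a * u * b) * u = (1 - a * u) * (1 - b * u) * 1.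
  by rewrite mulr1 mul_1B1B mulrBl mulrDl !mulrA.
exact: orth_mul.
Qed.

Lemma quasi_invertible_converse (R : pzRingType) (u : R) :
  @quasi_invertible R^c u <-> @quasi_invertible R u.
Proof.
(* Reversing the product turns [u * a] into [a * u], so the two witnesses trade places. *)
split=> -[a [b [ab ba]]]; exists b, a; split=> r.
- by rewrite -mulrA; exact: ab.
- by rewrite -mulrA; exact: ba.
- by rewrite -mulrA; exact: ab.
- by rewrite -mulrA; exact: ba.
Qed.

Lemma quasi_invertible_transfer (R : pzRingType) (a x b y : R) :
  a * x + b = 1 -> quasi_invertible (x + y * b) ->
  exists z : R, quasi_invertible (a + b * z).
Proof.
move=> axb1 /quasi_inverse_exists[v]; set u := x + y * b => uv.
have bE : b = 1 - a * x by rewrite -axb1 addrC addKr.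
have axE : a * x = 1 - b by rewrite bE subKr.
(* As [b = 1 - a * x], moving [a] or [x] across exchanges [b] and [1 - x * a]. *)
have abE : a * (1 - x * a) = b * a.
  by rewrite bE mulrBr mulr1 mulrBl mul1r mulrA.
have xbE : x * b = (1 - x * a) * x.
  by rewrite bE mulrBr mulr1 mulrBl mul1r mulrA.
have uE : (1 - y * a) * x = u - y.
  by rewrite mulrBl mul1r -mulrA axE mulrBr mulr1 opprB addrA.
exists (v * (1 - y * a)); set w := a + _; pose e := x + (1 - x * a) * y.
have ae : a * e = 1 - b * (1 - a * y).
  by rewrite /e mulrDr mulrA abE axE mulrBr mulr1 opprB addrA addrAC !mulrA.
have ye : (1 - y * a) * e = u * (1 - a * y).
  have yaE : (1 - y * a) * (1 - x * a) = 1 - u * a.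
    by rewrite mulrBr mulr1 mulrA uE mulrBl opprB addrA subrK.
  by rewrite /e mulrDr uE mulrA yaE mulrBl mul1r addrA subrK mulrBr mulr1 mulrA.
have eb : e * b = (1 - x * a) * u.
  by rewrite /e /u mulrDl mulrDr xbE mulrA.
have ea : e * a = 1 - (1 - x * a) * (1 - y * a).
  by rewrite /e mulrDl -mulrA mulrBr mulr1 opprB addrCA subKr addrC.
exists e, e.
have -> : 1 - w * e = b * (1 - v * u) * (1 - a * y).
  rewrite /w mulrDl ae -!mulrA ye opprD opprB addrA addrCA subrr addr0.
  by rewrite -mulrBr mulrBl mul1r mulrA.
have -> : 1 - e * w = (1 - x * a) * (1 - u * v) * (1 - y * a).
  rewrite /w mulrDr (mulrA e b) eb ea opprD opprB addrA addrCA subrr addr0.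
  by rewrite !mulrA -mulrBl; congr (_ * _); rewrite mulrBr mulr1 mulrA.
exact/orth_mul/orth_sym.
Qed.

Theorem theorem3p6 (R : pzRingType) :
  cl (@quasi_invertible R) = [set: R] <-> cr (@quasi_invertible R) = [set: R].
Proof.
split=> full; apply/seteqP; split=> // a _ x b.
  (* Multiplying by the inverse [t] on the right normalises the sum to [1], with [x * t] and [b * t]
     for [x] and [b]. *)
  case=> t [_]; rewrite mulrDl -mulrA => axbt.
  have : cl (@quasi_invertible R) (x * t) by rewrite full.
  move=> /(_ _ _ axbt)[y] /(quasi_invertible_transfer axbt)[z qz].
  by exists (t * z); rewrite mulrA.
move=> xab.
have [y qy] : exists y, quasi_invertible (x + b * y).
  have : cr (@quasi_invertible R) x by rewrite full.
  by move=> /(_ a b); apply; rewrite xab; exists 1; rewrite !mulr1.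
(* In [R^c], [xab] reads [a * x + b = 1] and [x + b * y] reads [x + y * b]; the resulting
   [a + b * z] is [a + z * b] in [R]. *)
have [|z qz] := @quasi_invertible_transfer R^c a x b y xab.
  exact/quasi_invertible_converse.
by exists z; apply/quasi_invertible_converse.
Qed.
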